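(* Let $G$ be a graph and let $k,k'$ be positive integers with $k'\leq k$. Suppose there are four vertices $x,y,u,v$ of $G$ such that $d_G(x,u)=d_G(x,v)=3k$, $d_G(u,v)=6k$ and $d_G(x,y)=3k+3k'$. Then $\mathrm{mp}(G)\geq 2k+k'$.
   Context: For a graph $G=(V,E)$, the ball of radius $r$ around $v$ is $N_r(v)=\{u\in V : d_G(u,v)\leq r\}$. A multipacking of $G$ is a set $P\subseteq V$ such that for every vertex $v$ and every positive integer $r$, $|N_r(v)\cap P|\leq r$. The multipacking number $\mathrm{mp}(G)$ is the maximum size of a multipacking of $G$. *)

(* Defs.v *)
From mathcomp Require Import all_boot.

Set Implicit Arguments.
Unset Strict Implicit.
Unset Printing Implicit Defensive.

Record sgraph := SGraph {
  vertex :> finType;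
  edge : rel vertex;
  edge_sym : symmetric edge;
  edge_irrefl : irreflexive edge
}.

Section Distance.
Variable G : sgraph.
Implicit Types (x y u v : G) (n r : nat) (P : {set G}).

Definition walk n x y : bool :=
  [exists p : n.-tuple G, path (@edge G) x p && (last x p == y)].

(* The length of a shortest walk, or None (infinite distance) when x and y lie
   in different components. Searching the lengths below #|G| is enough, since
   a shortest walk does not repeat a vertex; see gdistP and gdist_NoneP. *)
Definition gdist x y : option nat :=
  ohead [seq n <- iota 0 #|G| | walk n x y].

Lemma walkP n x y :
  reflect (exists p : seq G, [/\ size p = n, path (@edge G) x p & last x p = y])
          (walk n x y).
Proof.
apply: (iffP existsP) => [[p /andP[Pp /eqP lp]]|[p [sp Pp lp]]].
  by exists p; rewrite size_tuple.
by move/eqP: sp => sp; exists (Tuple sp); rewrite /= Pp lp eqxx.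
Qed.

Lemma walk_short n x y : walk n x y ->
  exists2 m, m <= n & (m < #|G|) && walk m x y.
Proof.
case/walkP=> p [<- Pp <-]; case: (shortenP Pp) => q Pq Uq sub_qp.
exists (size q).
  by apply: uniq_leq_size => //; case/andP: Uq.
apply/andP; split; last by apply/walkP; exists q.
by have := max_card (mem (x :: q)); rewrite (card_uniqP Uq).
Qed.

Lemma gdistP x y n :
  gdist x y = Some n <-> walk n x y /\ (forall m, walk m x y -> n <= m).
Proof.
have srt : sorted ltn [seq n <- iota 0 #|G| | walk n x y].
  by apply: sorted_filter (iota_ltn_sorted _ _) => a b c; apply: ltn_trans.
have memE m : (m \in [seq n <- iota 0 #|G| | walk n x y])
                = walk m x y && (m < #|G|).
  by rewrite mem_filter mem_iota.
rewrite /gdist; case: [seq _ <- _ | _] srt memE => [|a s] /= srt memE.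
  split=> // -[wn _]; have [m _ /andP[ltm wm]] := walk_short wn.
  by have := memE m; rewrite wm ltm.
have [wa _] : walk a x y /\ a < #|G|.
  by apply/andP; rewrite -memE mem_head.
have min_a m : walk m x y -> a <= m.
  move=> wm; have [m' lem' /andP[ltm' wm']] := walk_short wm.
  apply: leq_trans lem'; have : m' \in a :: s by rewrite memE wm' ltm'.
  rewrite inE => /predU1P[-> //|m's]; apply: ltnW.
  have trl : transitive ltn by move=> ? ? ?; apply: ltn_trans.
  by have /allP := order_path_min trl srt; apply.
split=> [[<-] //|[wn min_n]].
by congr Some; apply/eqP; rewrite eqn_leq min_a // min_n.
Qed.

Lemma gdist_NoneP x y : gdist x y = None <-> forall n, ~~ walk n x y.
Proof.
split=> [gN n|wN]; last first.
  case E: (gdist x y) => [n|] //; have [wn _] := (gdistP x y n).1 E.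
  by have := wN n; rewrite wn.
apply/negP=> wn; have [m _ /andP[ltm wm]] := walk_short wn.
have : m \in [seq n <- iota 0 #|G| | walk n x y].
  by rewrite mem_filter mem_iota wm.
by move: gN; rewrite /gdist; case: [seq _ <- _ | _].
Qed.

Definition ball r v : {set G} :=
  [set u | if gdist u v is Some n then n <= r else false].

Definition multipacking P : Prop :=
  forall v r, 0 < r -> #|ball r v :&: P| <= r.

Lemma multipacking_dec P : decidable (multipacking P).
Proof.
apply: (@decP _ [forall v : G, forall r : 'I_#|G|,
                   (0 < r) ==> (#|ball r v :&: P| <= r)]).
apply: (iffP forallP) => [mP v r r0|mP v].
  case: (ltnP r #|G|) => [ltr|ger]; last exact: leq_trans (max_card _) ger.
  by have /forallP/(_ (Ordinal ltr))/implyP := mP v; apply.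
by apply/forallP=> r; apply/implyP; apply: mP.
Qed.

End Distance.

Definition mp (G : sgraph) : nat :=
  \max_(P : {set G} | is_left (multipacking_dec P)) #|P|.

(* Main.v *)
(** Take every third vertex of the geodesics from [x] to [u] and to [v], leaving
   out [x], and every third vertex of a geodesic from [x] to [y] at distance more
   than [3k] from [x]. Index each by its level, a third of its distance to [x].
   Two chosen vertices in a common ball of radius [r] have levels at most
   [2r/3] apart, and levels of sum at most [2r/3] if one lies towards [u] and the
   other towards [v]. Bounding the vertices of each branch in the ball by the
   span of their levels, these constraints yield at most [r] of them. If the ball
   meets all three branches up to a high level of the third one, it misses the
   low levels of the first two, which pays for the vertices of the third. *)
Require Import Defs.
From mathcomp Require Import all_boot zify.

Set Implicit Arguments.
Unset Strict Implicit.
Unset Printing Implicit Defensive.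

Section Walks.
Variable G : sgraph.
Implicit Types (x y z c : G) (m n r : nat) (P : {set G}).

Lemma walk0 x : walk 0 x x.
Proof. by apply/walkP; exists [::]. Qed.

Lemma walk_cat m n x y z : walk m x y -> walk n y z -> walk (m + n) x z.
Proof.
move=> /walkP[p [<- Pp <-]] /walkP[q [<- Pq <-]].
by apply/walkP; exists (p ++ q); rewrite size_cat cat_path Pp Pq last_cat.
Qed.

Lemma walk_sym n x y : walk n x y -> walk n y x.
Proof.
move=> /walkP[p [<- Pp <-]]; apply/walkP; exists (rev (belast x p)); split.
- by rewrite size_rev size_belast.
- by rewrite rev_path; under eq_path => a b do rewrite edge_sym.
- by case: p {Pp} => //= a p; rewrite rev_cons last_rcons.
Qed.

(** The vertex reached after [i] steps splits the walk in two. The lengths of these two pieces are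
    all that is used of a geodesic later on. *)
Lemma walk_points n x y : walk n x y ->
  exists f : nat -> G, forall i, i <= n -> walk i x (f i) /\ walk (n - i) (f i) y.
Proof.
move=> /walkP[p [<- Pp <-]]; exists (fun i => last x (take i p)) => i lei.
move: Pp; rewrite -{1}(cat_take_drop i p) cat_path => /andP[P1 P2].
split; apply/walkP; first by exists (take i p); rewrite size_takel.
by exists (drop i p); rewrite size_drop -last_cat cat_take_drop.
Qed.

Lemma gdist_walk x y n : gdist x y = Some n -> walk n x y.
Proof. by case/gdistP. Qed.

Lemma gdist_min x y n m : gdist x y = Some n -> walk m x y -> n <= m.
Proof. by case/gdistP=> _; apply. Qed.

Lemma ball_walk r c x : x \in ball r c -> exists2 n, n <= r & walk n x c.
Proof.
rewrite inE; case E: (gdist x c) => [n|//] len.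
by exists n => //; apply: gdist_walk.
Qed.

Lemma ball_walk2 r c x y : x \in ball r c -> y \in ball r c ->
  exists2 n, n <= 2 * r & walk n x y.
Proof.
move=> /ball_walk[m lem wm] /ball_walk[n len wn].
by exists (m + n); [lia | exact: walk_cat wm (walk_sym wn)].
Qed.

Lemma leq_mp P : multipacking P -> #|P| <= mp G.
Proof.
move=> mP; apply: (leq_bigmax_cond (F := fun P : {set G} => #|P|)).
by case: (multipacking_dec P).
Qed.

(** Passing from sets to lists lets the count in a ball split as a sum over concatenated
    branches. *)
Lemma multipacking_seq (s : seq G) : uniq s ->
  (forall c r, 0 < r -> count (mem (ball r c)) s <= r) -> size s <= mp G.
Proof.
move=> us cs; rewrite -(card_uniqP us) -cardsE; apply: leq_mp => c r r0.
apply: leq_trans (cs c r r0); rewrite -size_filter.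
apply: leq_trans (card_size _); apply: subset_leq_card.
by apply/subsetP=> z; rewrite !inE mem_filter !inE.
Qed.

End Walks.

(** The extreme members are produced as witnesses, so that constraints on pairs of levels bound a
    whole count. *)
Lemma count_iota_span (A : pred nat) s n :
  count A (iota s n) = 0 \/
  exists lo hi, [/\ A lo, A hi, s <= lo <= hi, hi < s + n
                  & count A (iota s n) <= hi - lo + 1].
Proof.
elim: n s => [|n IH] s /=; first by left.
case: (IH s.+1) => [->|[lo [hi [Alo Ahi le1 le2 le3]]]]; case: (boolP (A s)) => As.
- by right; exists s, s; split=> //; lia.
- by left.
- by right; exists s, hi; split=> //; lia.
- by right; exists lo, hi; split=> //; lia.
Qed.

(** Only the lowest and highest level met on each branch matter. This leaves eight cases of integer
    linear arithmetic, according to which branches are met. *)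
Lemma three_branch_count (A B C : pred nat) k k' r : 0 < r -> k' <= k ->
  (forall i j, 0 < i <= k -> 0 < j <= k -> A i -> A j -> 3 * i <= 3 * j + 2 * r) ->
  (forall i j, 0 < i <= k -> 0 < j <= k -> B i -> B j -> 3 * i <= 3 * j + 2 * r) ->
  (forall i j, k < i <= k + k' -> k < j <= k + k' ->
     C i -> C j -> 3 * i <= 3 * j + 2 * r) ->
  (forall i j, 0 < i <= k -> 0 < j <= k -> A i -> B j -> 3 * (i + j) <= 2 * r) ->
  (forall i j, k < i <= k + k' -> 0 < j <= k -> C i -> A j -> 3 * i <= 3 * j + 2 * r) ->
  (forall i j, k < i <= k + k' -> 0 < j <= k -> C i -> B j -> 3 * i <= 3 * j + 2 * r) ->
  count A (iota 1 k) + count B (iota 1 k) + count C (iota k.+1 k') <= r.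
Proof.
move=> r0 lek AA BB CC AB CA CB.
case: (count_iota_span A 1 k) => [->|[a [a' [Aa Aa' a1 a2 ca]]]];
case: (count_iota_span B 1 k) => [->|[b [b' [Bb Bb' b1 b2 cb]]]];
case: (count_iota_span C k.+1 k') => [->|[c [c' [Cc Cc' c1 c2 cc]]]].
- lia.
- have := CC c' c ltac:(lia) ltac:(lia) Cc' Cc; lia.
- have := BB b' b ltac:(lia) ltac:(lia) Bb' Bb; lia.
(* Since [b' <= k < c], the two spans are disjoint and hold at most [c' - b + 1] levels, and 2r/3
   rounded down is at most [r - 1]. *)
- have := CB c' b ltac:(lia) ltac:(lia) Cc' Bb; lia.
- have := AA a' a ltac:(lia) ltac:(lia) Aa' Aa; lia.
- have := CA c' a ltac:(lia) ltac:(lia) Cc' Aa; lia.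
- have := AB a' b' ltac:(lia) ltac:(lia) Aa' Bb'; lia.
(* If [3 * k <= r + 2], the bounds on [a' + b'] and [k' <= k] suffice. Otherwise [1 <= a], [k < c]
   and c' - 2r/3 <= b bound the total by 4r/3 - k + 1, which is at most [r]. *)
- have := AB a' b' ltac:(lia) ltac:(lia) Aa' Bb'.
  have := CA c' a ltac:(lia) ltac:(lia) Cc' Aa.
  have := CB c' b ltac:(lia) ltac:(lia) Cc' Bb.
  lia.
Qed.

Theorem theorem5 (G : sgraph) (k k' : nat) (hk : 0 < k) (hk' : 0 < k')
  (hk'k : k' <= k) (x y u v : G)
  (hxu : gdist x u = Some (3 * k)) (hxv : gdist x v = Some (3 * k))
  (huv : gdist u v = Some (6 * k)) (hxy : gdist x y = Some (3 * k + 3 * k')) :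
  2 * k + k' <= mp G.
Proof.
have [f fP] := walk_points (gdist_walk hxu).
have [g gP] := walk_points (gdist_walk hxv).
have [h hP] := walk_points (gdist_walk hxy).
(* Only [w] needs to lie on a geodesic from [x] to [b]: a detour through [z] cannot be shorter.
   Hence [z] may be on another branch. *)
have level (a b z w : G) m i j l : gdist x b = Some m ->
    walk i x z -> j <= m -> walk (m - j) w b -> walk l w z -> j <= i + l.
  move=> db wz lej wb wl.
  by have := gdist_min db (walk_cat (walk_cat wz (walk_sym wl)) wb); lia.
(* The route from [u] to [v] through [f i] and [g j] has length at least [6 * k]. *)
have opp i j l : i <= 3 * k -> j <= 3 * k -> walk l (f i) (g j) -> i + j <= l.
  move=> lei lej wl; have [_ wf] := fP i lei; have [_ wg] := gP j lej.
  by have := gdist_min huv (walk_cat (walk_cat (walk_sym wf) wl) wg); lia.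
pose F i := f (3 * i); pose F' i := g (3 * i); pose H i := h (3 * i).
have inF i : i <= k -> walk (3 * i) x (F i) /\ walk (3 * k - 3 * i) (F i) u.
  by move=> lei; apply: fP; lia.
have inF' i : i <= k -> walk (3 * i) x (F' i) /\ walk (3 * k - 3 * i) (F' i) v.
  by move=> lei; apply: gP; lia.
have inH i : i <= k + k' ->
    walk (3 * i) x (H i) /\ walk (3 * k + 3 * k' - 3 * i) (H i) y.
  by move=> lei; apply: hP; lia.
have FF i j l : i <= k -> j <= k -> walk l (F i) (F j) -> 3 * i <= 3 * j + l.
  move=> lei lej;
  apply: (level x u _ _ _ _ _ _ hxu (inF j lej).1 _ (inF i lei).2); lia.
have F'F' i j l : i <= k -> j <= k -> walk l (F' i) (F' j) -> 3 * i <= 3 * j + l.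
  move=> lei lej;
  apply: (level x v _ _ _ _ _ _ hxv (inF' j lej).1 _ (inF' i lei).2); lia.
have HH i j l : i <= k + k' -> j <= k + k' -> walk l (H i) (H j) ->
    3 * i <= 3 * j + l.
  move=> lei lej;
  apply: (level x y _ _ _ _ _ _ hxy (inH j lej).1 _ (inH i lei).2); lia.
have HF i j l : i <= k + k' -> j <= k -> walk l (H i) (F j) -> 3 * i <= 3 * j + l.
  move=> lei lej;
  apply: (level x y _ _ _ _ _ _ hxy (inF j lej).1 _ (inH i lei).2); lia.
have HF' i j l : i <= k + k' -> j <= k -> walk l (H i) (F' j) ->
    3 * i <= 3 * j + l.
  move=> lei lej;
  apply: (level x y _ _ _ _ _ _ hxy (inF' j lej).1 _ (inH i lei).2); lia.
have FF' i j l : i <= k -> j <= k -> walk l (F i) (F' j) -> 3 * (i + j) <= l.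
  by move=> lei lej wl; rewrite mulnDr; apply: opp wl; lia.
(* Levels of [H] start above [k] because its geodesic may share its beginning with the other two. *)
pose s := map F (iota 1 k) ++ map F' (iota 1 k) ++ map H (iota k.+1 k').
have <- : size s = 2 * k + k' by rewrite !size_cat !size_map !size_iota; lia.
(* Equal vertices are joined by a walk of length 0, so the same inequalities also show that the
   chosen vertices are distinct. *)
have eq_walk0 (z w : G) : z = w -> walk 0 z w by move=> ->; apply: walk0.
apply: multipacking_seq => [|c r r0].
- rewrite !cat_uniq !map_inj_in_uniq ?iota_uniq /= ?andbT.
  + rewrite has_cat negb_or -andbA; apply/and3P; split.
    * apply/hasPn=> _ /mapP[i iI ->]; apply/negP=> /mapP[j jI] /esym/eq_walk0.
      by rewrite !mem_iota in iI jI => /FF'; lia.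
    * apply/hasPn=> _ /mapP[i iI ->]; apply/negP=> /mapP[j jI] /eq_walk0.
      by rewrite !mem_iota in iI jI => /HF; lia.
    * apply/hasPn=> _ /mapP[i iI ->]; apply/negP=> /mapP[j jI] /eq_walk0.
      by rewrite !mem_iota in iI jI => /HF'; lia.
  + move=> i j; rewrite !mem_iota => iI jI e.
    have := HH _ _ _ _ _ (eq_walk0 _ _ e).
    by have := HH _ _ _ _ _ (eq_walk0 _ _ (esym e)); lia.
  + move=> i j; rewrite !mem_iota => iI jI e.
    have := F'F' _ _ _ _ _ (eq_walk0 _ _ e).
    by have := F'F' _ _ _ _ _ (eq_walk0 _ _ (esym e)); lia.
  + move=> i j; rewrite !mem_iota => iI jI e.
    have := FF _ _ _ _ _ (eq_walk0 _ _ e).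
    by have := FF _ _ _ _ _ (eq_walk0 _ _ (esym e)); lia.
- rewrite !count_cat !count_map addnA.
  apply: three_branch_count => // i j iI jI /= bi bj;
    have [l ler wl] := ball_walk2 bi bj.
  + by have := FF _ _ _ _ _ wl; lia.
  + by have := F'F' _ _ _ _ _ wl; lia.
  + by have := HH _ _ _ _ _ wl; lia.
  + by have := FF' _ _ _ _ _ wl; lia.
  + by have := HF _ _ _ _ _ wl; lia.
  + by have := HF' _ _ _ _ _ wl; lia.
Qed.
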